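(* Let $m$ be a positive integer with $m<n$. The set of all elements of $D_n$ of the form $$w_1^{j_1}\cdot t_2^{i_2}\cdot w_2^{j_2}\cdot t_3^{i_3}\cdots w_{m-1}^{j_{m-1}}\cdot t_m^{i_m}\cdot w_m^{j_m},$$ with $0\le j_k\le 1$ for $1\le k\le m$ and $0\le i_k\le k-1$ for $2\le k\le m$ (for $m=1$ this is just $w_1^{j_1}$), is a subgroup of $D_n$ isomorphic to the hyperoctahedral group $B_m$.
   Context: $D_n$ ($n\ge 2$) is the Coxeter group with generators $s_{1'},s_1,\dots,s_{n-1}$ and relations $s^2=1$ for each generator, $(s_i s_{i+1})^3=1$, $(s_is_j)^2=1$ for $|i-j|\ge 2$, $(s_{1'}s_2)^3=1$, and $(s_{1'}s_i)^2=1$ for $i\ne 2$. For $2\le k\le n$, $t_k=s_1 s_2\cdots s_{k-1}$; for $1\le k\le n-1$, $w_k=s_k s_{k-1}\cdots s_2 s_1 s_{1'} s_2\cdots s_k$. $B_m$ denotes the group of signed permutations of $\{\pm1,\dots,\pm m\}$ (bijections $\sigma$ with $\sigma(-i)=-\sigma(i)$), of order $2^m m!$. *)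

(* Defs.v *)
From mathcomp Require Import all_boot all_fingroup.
Set Implicit Arguments. Unset Strict Implicit. Unset Printing Implicit Defensive.
Local Open Scope group_scope.

(* Coxeter relations of type D_n on candidate generators
   sp = s_{1'} and s i = s_i (only 1 <= i <= n-1 is relevant). *)
Definition Dn_rel (gT : finGroupType) (n : nat) (sp : gT) (s : nat -> gT) : Prop :=
  [/\ sp ^+ 2 = 1 /\ (forall i, 1 <= i <= n.-1 -> s i ^+ 2 = 1),
      (forall i, 1 <= i -> i.+1 <= n.-1 -> (s i * s i.+1) ^+ 3 = 1),
      (forall i j, 1 <= i <= n.-1 -> 1 <= j <= n.-1 -> (i + 2 <= j) || (j + 2 <= i) ->
          (s i * s j) ^+ 2 = 1),
      (2 <= n.-1 -> (sp * s 2) ^+ 3 = 1)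
    & (forall i, 1 <= i <= n.-1 -> i != 2 -> (sp * s i) ^+ 2 = 1)].

Definition Dn_gens (gT : finGroupType) (n : nat) (sp : gT) (s : nat -> gT)
  : {set gT} := sp |: [set s i.+1 | i : 'I_n.-1].

(* G (with generators sp, s) is the Coxeter group D_n: it is generated by
   the generators, they satisfy the Coxeter relations, and it has the
   universal property of the presented group (for every group with elements
   satisfying the relations there is a homomorphism from G sending the
   generators to them). *)
Definition is_Coxeter_Dn (gT : finGroupType) (n : nat) (G : {group gT})
  (sp : gT) (s : nat -> gT) : Prop :=
  [/\ G :=: <<Dn_gens n sp s>>,
      Dn_rel n sp s
    & forall (hT : finGroupType) (hp : hT) (h : nat -> hT),
        Dn_rel n hp h ->
        exists f : {morphism G >-> hT},
          f sp = hp /\ (forall i, 1 <= i <= n.-1 -> f (s i) = h i)].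

Definition tD (gT : finGroupType) (s : nat -> gT) (k : nat) : gT :=
  \prod_(1 <= i < k) s i.

Definition wD (gT : finGroupType) (sp : gT) (s : nat -> gT) (k : nat) : gT :=
  (\prod_(i <- rev (iota 1%N k)) s i) * sp * \prod_(2 <= i < k.+1) s i.

Definition word_elt (gT : finGroupType) (sp : gT) (s : nat -> gT) (m : nat)
  (i j : nat -> nat) : gT :=
  wD sp s 1%N ^+ j 1%N * \prod_(2 <= k < m.+1) (tD s k ^+ i k * wD sp s k ^+ j k).

Definition word_set (gT : finGroupType) (sp : gT) (s : nat -> gT) (m : nat)
  : {set gT} :=
  [set word_elt sp s m (fun k => i (inord k)) (fun k => nat_of_bool (j (inord k)))
    | i : {ffun 'I_m.+1 -> 'I_m.+1} in [set i : {ffun 'I_m.+1 -> 'I_m.+1} |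
              [forall k : 'I_m.+1, (2 <= k)%N ==> (i k < k)%N]],
      j : {ffun 'I_m.+1 -> bool} in [set: {ffun 'I_m.+1 -> bool}]].

(* Hyperoctahedral group B_m: signed permutations of {+-1,...,+-m}.
   The element +-(i+1) is encoded as (i, b) with i : 'I_m, b = true meaning
   the negative sign. *)
Definition sneg (m : nat) (x : 'I_m * bool) : 'I_m * bool := (x.1, ~~ x.2).

Definition Bset (m : nat) : {set {perm ('I_m * bool)}} :=
  [set p : {perm ('I_m * bool)} | [forall x, p (sneg x) == sneg (p x)]].

(* Main.v *)
Require Import Defs.
From mathcomp Require Import all_boot all_fingroup.
From mathcomp Require Import zify.
Local Open Scope group_scope.

Set Implicit Arguments.
Unset Strict Implicit.
Unset Printing Implicit Defensive.

(** In the reflection representation of [D_n] on [{±1, ..., ±n}], [w_k] changes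
    the signs of [1] and [k+1], and [t_k] is a [k]-cycle on the first [k]
    coordinates. Let [H_k] be the subgroup generated by [s_1, ..., s_{k-1}] and
    [w_1, ..., w_k]. The Coxeter relations alone show that [H_{k+1}] is a union
    of at most [2(k+1)] right cosets of [H_k], with representatives
    [s_k ... s_a * w_{k+1}^j]. In the representation, [H_k] fixes [k+1] up to sign
    and fixes [k+2], whereas [t_{k+1}^i * w_{k+1}^j] sends [k+1] to [±(k+1-i)] and
    multiplies [k+2] by [(-1)^j]; hence the [2(k+1)] elements
    [t_{k+1}^i * w_{k+1}^j] are in distinct cosets and represent all of them.
    By induction [H_m] is the set of words, of order [2^m m!]. Elements of [H_m]
    preserve [{±1, ..., ±m}], an element acting trivially there is trivial, and
    comparing orders identifies [H_m] with [B_m]. *)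

(** * Coxeter relations and the cosets of the subgroups [H_k] *)

Lemma invol_inv (gT : finGroupType) (x : gT) : x ^+ 2 = 1 -> x^-1 = x.
Proof. by move=> x2; apply/eqP; rewrite eq_invg_mul -expg2 x2. Qed.

Lemma invol_commute (gT : finGroupType) (x y : gT) :
  x ^+ 2 = 1 -> y ^+ 2 = 1 -> (x * y) ^+ 2 = 1 -> commute x y.
Proof.
move=> /invol_inv xV /invol_inv yV /invol_inv.
by rewrite invMg xV yV => /esym.
Qed.

Lemma invol_braid (gT : finGroupType) (x y : gT) :
  x ^+ 2 = 1 -> y ^+ 2 = 1 -> (x * y) ^+ 3 = 1 -> x * y * x = y * x * y.
Proof.
move=> /invol_inv xV /invol_inv yV xy3.
have : (x * y * x) * (y * x * y) = 1 by rewrite -xy3 !expgS expg0 mulg1 !mulgA.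
by move=> /eqP; rewrite -eq_invg_mul !invMg xV yV mulgA => /eqP.
Qed.

(** With [a], [b], [c] equal to $s_1$, $s_{1'}$, $s_2$, this is the case $k=2$ of [w_s1]. *)
Lemma braid_commute_shift (gT : finGroupType) (a b c : gT) :
    a * c * a = c * a * c -> b * c * b = c * b * c -> commute a b ->
  c * a * b * c * a = b * c * a * b * c.
Proof.
move=> aca bcb ab.
have -> : c * a * b * c * a = c * b * (a * c * a) by rewrite -(mulgA c a) ab !mulgA.
have -> : c * b * (a * c * a) = (c * b * c) * a * c by rewrite aca !mulgA.
by rewrite -bcb -(mulgA (b * c)) -ab !mulgA.
Qed.

Section Algebra.

Variables (gT : finGroupType) (n : nat) (sp : gT) (s : nat -> gT).
Hypothesis rel : Dn_rel n sp s.

Local Notation w := (wD sp s).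

Lemma sK i : 0 < i < n -> s i ^+ 2 = 1.
Proof. by case: rel => -[_ h] _ _ _ _ hi; apply: h; lia. Qed.

Lemma sV i : 0 < i < n -> (s i)^-1 = s i.
Proof. by move=> hi; apply/invol_inv/sK. Qed.

Lemma s_far i j : 0 < i -> i.+1 < j -> j < n -> commute (s i) (s j).
Proof.
move=> hi hij hj; apply: invol_commute; [apply: sK; lia | apply: sK; lia |].
by case: rel => _ _ h _ _; apply: h; lia.
Qed.

Lemma s_braid i : 0 < i -> i.+1 < n -> s i * s i.+1 * s i = s i.+1 * s i * s i.+1.
Proof.
move=> hi hij; apply: invol_braid; [apply: sK; lia | apply: sK; lia |].
by case: rel => _ h _ _ _; apply: h; lia.
Qed.

Lemma spK : sp ^+ 2 = 1.
Proof. by case: rel => -[]. Qed.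

Lemma sp_far i : 0 < i < n -> i != 2 -> commute sp (s i).
Proof.
move=> hi hi2; apply: invol_commute; [exact: spK | apply: sK; lia |].
by case: rel => _ _ _ _ h; apply: h => //; lia.
Qed.

Lemma sp_braid : 2 < n -> sp * s 2 * sp = s 2 * sp * s 2.
Proof.
move=> hn; apply: invol_braid; [exact: spK | apply: sK; lia |].
by case: rel => _ _ _ h _; apply: h; lia.
Qed.

(** * Conjugation of the $w_k$ by the $s_i$ *)

Lemma w1E : w 1%N = s 1%N * sp.
Proof. by rewrite /wD /= big_seq1 big_geq ?mulg1. Qed.

Lemma wS k : 0 < k -> k.+1 < n -> w k.+1 = w k ^ s k.+1.
Proof.
move=> hk hkn; rewrite /wD conjgE sV; last lia.
have -> : iota 1%N k.+1 = iota 1%N k ++ [:: k.+1] by rewrite -[in LHS](addn1 k) iotaD.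
rewrite rev_cat big_cat /= big_seq1.
by rewrite [\prod_(2 <= i < k.+2) s i]big_nat_recr //= !mulgA.
Qed.

Lemma wS_s k : 0 < k -> k.+1 < n -> w k.+1 ^ s k.+1 = w k.
Proof.
move=> hk hkn; rewrite wS // -conjgM -expg2 sK ?conjg1 //; lia.
Qed.

Lemma w_sqr k : 0 < k < n -> w k ^+ 2 = 1.
Proof.
elim: k => // -[|k] IH hk; last by rewrite wS -?conjXg ?IH ?conj1g //; lia.
rewrite w1E expgMn; last by apply/commute_sym/sp_far.
by rewrite spK sK ?mulg1.
Qed.

Lemma wV k : 0 < k < n -> (w k)^-1 = w k.
Proof. by move=> hk; apply/invol_inv/w_sqr. Qed.

Lemma w_s_gt k i : 0 < k -> k.+1 < i -> i < n -> w k ^ s i = w k.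
Proof.
move=> hk hki hi; elim: k hk hki => // -[|k] IH _ hki.
  rewrite w1E; apply/conjg_fixP/commgP/commute_sym/commuteM; apply: commute_sym.
    by apply: s_far.
  by apply: sp_far; lia.
rewrite wS //; last lia.
rewrite -conjgM s_far //.
by rewrite conjgM IH //; lia.
Qed.

(** Since $s_i$ commutes with the later conjugators, the case $k=i+1$ decides. There $w_{i+1}$ is
    $w_{i-1}$ conjugated by $s_i s_{i+1}$; the braid relation turns $s_i s_{i+1} s_i$ into $s_{i+1}
    s_i s_{i+1}$, whose first factor fixes $w_{i-1}$. *)
Lemma w_s_lt k i : 1 < i -> i < k -> k < n -> w k ^ s i = w k.
Proof.
elim: k => // k IH hi; rewrite ltnS leq_eqVlt => /predU1P[<-|hik] hk.
  rewrite wS //; last lia.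
  case: i hi hk {IH} => [|[|i]] // _ hi.
  rewrite wS //; last lia.
  by rewrite -!(conjgM (w i.+1)) s_braid // !conjgM w_s_gt.
rewrite wS //; last lia.
by rewrite -conjgM -s_far ?conjgM ?IH //; lia.
Qed.

Lemma w1_s1 : 1 < n -> w 1%N ^ s 1%N = w 1%N.
Proof.
move=> hn; apply/conjg_fixP/commgP; rewrite w1E.
apply: commute_sym; apply: commuteM => //.
by apply/commute_sym/sp_far.
Qed.

(** In terms of signs: conjugation by $s_1$ turns the sign change at $1,k+1$ into the one at
    $2,k+1$, which is the product of those at $1,2$ and at $1,k+1$. *)
Lemma w_s1 k : 1 < k -> k < n -> w k ^ s 1%N = w 1%N * w k.
Proof.
elim: k => // -[|[|k]] IH // _ hk; last first.
  rewrite wS //= -conjgM -s_far // conjgM IH //; last lia.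
  by rewrite conjMg (w_s_gt (k := 1)).
rewrite wS // w1E !conjgE !sV //; last lia.
rewrite -!mulgA; congr (_ * _).
rewrite !mulgA; apply: braid_commute_shift.
- exact: s_braid.
- exact: sp_braid.
- by apply/commute_sym/sp_far; lia.
Qed.

(** For $i=1$, $w_1 w_k$ is a conjugate of $w_k$, hence squares to 1. Conjugating by $s_i$, which
    fixes $w_k$, passes from $w_{i-1}$ to $w_i$. *)
Lemma w_commute_lt i k : 0 < i -> i < k -> k < n -> commute (w i) (w k).
Proof.
move=> hi hik hk; elim: i hi hik => // -[|i] IH _ hik.
  apply: invol_commute; [apply: w_sqr; lia | apply: w_sqr; lia |].
  by rewrite -w_s1 // -conjXg w_sqr ?conj1g //; lia.
rewrite /commute wS //; last lia.
rewrite -(w_s_lt _ hik) // -!conjMg IH //; lia.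
Qed.

Lemma w_commute i k : 0 < i < n -> 0 < k < n -> commute (w i) (w k).
Proof.
move=> hi hk; case: (ltngtP i k) => [lt_ik | lt_ki | -> //].
  by apply: w_commute_lt; lia.
by apply/commute_sym/w_commute_lt; lia.
Qed.

(** * The subgroups $H_k$ and the rewriting of their right cosets *)

Definition Wgens k : {set gT} := [set w i.+1 | i : 'I_k].
Definition Sgens k : {set gT} := [set s i | i : 'I_k & 0 < i].
Definition wgrp k : {group gT} := <<Wgens k>>%G.
(** This is $H_k$: the $s_i$ stop at $k-1$, the $w_i$ at $k$. *)
Definition hyper k : {group gT} := <<Sgens k :|: Wgens k>>%G.

Lemma w_Wgens i k : 0 < i <= k -> w i \in Wgens k.
Proof.
case: i => // i hi; apply/imsetP; exists (Ordinal hi) => //.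
Qed.

Lemma w_wgrp i k : 0 < i <= k -> w i \in wgrp k.
Proof. by move=> hi; apply/mem_gen/w_Wgens. Qed.

Lemma w_hyper i k : 0 < i <= k -> w i \in hyper k.
Proof. by move=> hi; apply/mem_gen/setUP; right; apply: w_Wgens. Qed.

Lemma s_hyper i k : 0 < i < k -> s i \in hyper k.
Proof.
move=> /andP[i0 ik]; apply/mem_gen/setUP; left.
by apply/imsetP; exists (Ordinal ik) => //; rewrite inE.
Qed.

Lemma wgrp_sub_hyper k : wgrp k \subset hyper k.
Proof. exact/genS/subsetUr. Qed.

Lemma hyper_sub (H : {group gT}) k :
    (forall i, 0 < i < k -> s i \in H) -> (forall i, 0 < i <= k -> w i \in H) ->
  hyper k \subset H.
Proof.
move=> sH wH; rewrite gen_subG subUset; apply/andP; split; apply/subsetP=> x.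
  by move=> /imsetP[i]; rewrite inE => i0 ->; apply: sH; rewrite i0 /=.
by move=> /imsetP[i _ ->]; apply: wH; rewrite /=.
Qed.

Lemma hyperS k : hyper k \subset hyper k.+1.
Proof.
by apply: hyper_sub => i hi; [apply: s_hyper | apply: w_hyper]; lia.
Qed.

(** Each $s_i$ with $i>1$ permutes the generators $w_j$, and $s_1$ multiplies those with $j>1$ by
    $w_1$. The range includes $s_k$, which occurs in [down k.+1 a]. *)
Lemma s_norm_wgrp i k : 0 < i <= k -> k < n -> s i \in 'N(wgrp k).
Proof.
move=> hi hk; rewrite inE -genJ gen_subG; apply/subsetP=> _ /imsetP[_ /imsetP[[j hj] _ ->] ->] /=.
case: (ltngtP i j.+1) => [ij|ij|ij].
- have [i1|i1] : i = 1%N \/ 1 < i by lia.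
    by rewrite i1 w_s1; [apply: groupM; apply: w_wgrp; lia | lia | lia].
  by rewrite w_s_lt ?w_wgrp //; lia.
- have [i1|i1] : i = j.+2 \/ j.+2 < i by lia.
    by rewrite i1 -wS ?w_wgrp //; lia.
  by rewrite w_s_gt ?w_wgrp //; lia.
- rewrite ij; case: j hj ij => [|j] hj ij.
    by rewrite w1_s1 ?w_wgrp //; lia.
  by rewrite wS_s ?w_wgrp //; lia.
Qed.

(* [down k a] is [s_{k-1} ... s_a], trivial for [a = k]. *)
Definition down k a : gT := \prod_(i <- rev (iota a (k - a))) s i.

Lemma down_id k : down k k = 1.
Proof. by rewrite /down subnn big_nil. Qed.

Lemma down_rec k a : a < k -> down k a = down k a.+1 * s a.
Proof.
move=> ak; rewrite /down (_ : (k - a = (k - a.+1).+1)%N); last lia.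
by rewrite /= rev_cons -cats1 big_cat big_seq1.
Qed.

Lemma down_rec_s k a : 0 < a < k -> k <= n -> down k a * s a = down k a.+1.
Proof.
move=> hak kn; rewrite down_rec; last lia.
by rewrite -mulgA -expg2 sK ?mulg1 //; lia.
Qed.

Lemma down_s_lt k a j : 0 < j -> j.+1 < a -> a <= k -> k <= n ->
  commute (s j) (down k a).
Proof.
move=> j0 ja ak kn; rewrite /down big_seq; apply: big_ind => [|x y|i].
- exact: commute1.
- exact: commuteM.
by rewrite mem_rev mem_iota => hi; apply: s_far => //; lia.
Qed.

(** Moving left, $s_j$ passes the far factors until it meets $s_j s_{j-1}$; the braid relation makes
    it $s_{j-1}$, which commutes with the rest. The induction is on $j-a$. *)
Lemma down_s_gt k a j : 0 < a -> a < j -> j < k -> k <= n ->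
  down k a * s j = s j.-1 * down k a.
Proof.
move=> a0 aj jk kn; have [d da] : exists d, (a + d.+1 = j)%N by exists (j - a.+1)%N; lia.
elim: d a da a0 {aj} => [|d IH] a da a0.
  rewrite -da addn1 /= (@down_rec k a) ?(@down_rec k a.+1) //; try lia.
  have -> : down k a.+2 * s a.+1 * s a * s a.+1 =
      down k a.+2 * (s a.+1 * s a * s a.+1) by rewrite !mulgA.
  rewrite -s_braid ?mulgA; try lia.
  by congr (_ * _ * _); apply/commute_sym/down_s_lt; lia.
rewrite (@down_rec k a); last lia.
rewrite -mulgA s_far //; try lia.
by rewrite mulgA IH ?mulgA //; lia.
Qed.

Lemma down_norm_wgrp k a : 0 < a <= k.+1 -> k < n -> down k.+1 a \in 'N(wgrp k).
Proof.
move=> ha kn; rewrite /down big_seq; apply: group_prod => i.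
by rewrite mem_rev mem_iota => hi; apply: s_norm_wgrp; lia.
Qed.

(** The same rewriting enumerates the cosets of a symmetric group in the next one: $i=a$ and $i=a-1$
    change the representative, any other $s_i$ moves to the left and is absorbed. *)
Lemma down_coset k a i : 0 < a <= k.+1 -> 0 < i <= k -> k < n ->
  exists2 b, 0 < b <= k.+1 &
  exists2 h, h \in hyper k & down k.+1 a * s i = h * down k.+1 b.
Proof.
move=> ha hi kn.
have [e|[e|[e|e]]] : i = a \/ i.+1 = a \/ i.+1 < a \/ a < i by lia.
- exists a.+1; [lia | exists 1; rewrite ?group1 // mul1g e down_rec_s //; lia].
- exists i; [lia | exists 1; rewrite ?group1 // mul1g -e -down_rec //; lia].
- exists a => //; exists (s i); first by apply: s_hyper; lia.
  by apply/commute_sym/down_s_lt; lia.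
exists a => //; exists (s i.-1); first by apply: s_hyper; lia.
by apply: down_s_gt; lia.
Qed.

Lemma w_s_wgrp k i : 0 < i <= k -> k.+1 < n ->
  exists2 u, u \in wgrp k & w k.+1 * s i = s i * u * w k.+1.
Proof.
move=> hi hk; have [e|e] : i = 1%N \/ 1 < i by lia.
  exists (w 1%N); first by apply: w_wgrp; lia.
  rewrite e -(mulgA (s _)) -w_s1 //; last lia.
  by rewrite conjgE !mulgA mulgV mul1g.
exists 1; rewrite ?group1 // mulg1.
rewrite -[w k.+1 in RHS](w_s_lt (i := i)) //; last lia.
by rewrite conjgE !mulgA mulgV mul1g.
Qed.

(** The products on the right contain 1 and are stable under right multiplication by each generator
    of $H_{k+1}$; this bounds the number of cosets by $2(k+1)$. *)
Lemma hyper_coset k g : k.+1 < n -> g \in hyper k.+1 ->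
  exists h a (b : bool),
    [/\ h \in hyper k, 0 < a <= k.+1 & g = h * (down k.+1 a * w k.+1 ^+ b)].
Proof.
move=> kn /gen_prodgP[l [c cgen ->]] {g}.
elim: l c cgen => [|l IH] c cgen.
  exists 1, k.+1, false; rewrite big_ord0 group1 down_id !mulg1; split => //; lia.
rewrite big_ord_recr /=; have [|h [a [b [hh ha ->]]]] := IH (fun i => c (widen_ord (leqnSn l) i)).
  by move=> i; apply: cgen.
(* Elements of [wgrp k] cross the descending product to the left, because it normalizes [wgrp k]. *)
have wmove u d : u \in wgrp k -> 0 < d <= k.+1 ->
    exists2 u', u' \in hyper k & down k.+1 d * u = u' * down k.+1 d.
  move=> hu hd; exists (u ^ (down k.+1 d)^-1); last first.
    by rewrite conjgE invgK !mulgA mulgKV.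
  apply: (subsetP (wgrp_sub_hyper k)); rewrite memJ_norm // groupV.
  by apply: down_norm_wgrp => //; lia.
have := cgen ord_max; case/setUP=> /imsetP[i]; rewrite ?inE => hi ->.
  (* Generator $s_i$: it crosses $w_{k+1}$ with a correction [u] in [wgrp k], then changes the
     descending product by [down_coset]. *)
  have hik : 0 < i <= k by rewrite hi -ltnS ltn_ord.
  have [u hu eu] : exists2 u, u \in wgrp k & w k.+1 ^+ b * s i = s i * u * w k.+1 ^+ b.
    case: b; first by rewrite expg1; apply: w_s_wgrp.
    by exists 1; rewrite ?group1 // !mulg1 mul1g.
  have [a' ha' [h' hh' e']] := down_coset ha hik (ltnW kn).
  have [u' hu' eu'] := wmove _ _ hu ha'.
  exists (h * h' * u'), a', b; rewrite !groupM //; split => //.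
  rewrite -!mulgA eu !mulgA -(mulgA h (down _ _)) e' -!mulgA.
  by rewrite (mulgA _ u) eu' !mulgA.
(* Generator $w_{i+1}$: for $i<k$ it commutes with $w_{k+1}$ and is absorbed on the left; for $i=k$
   it toggles the exponent [b]. *)
have [ik|ik] : i < k \/ i = k :> nat by have := ltn_ord i; lia.
  have hw : w i.+1 \in wgrp k by apply: w_wgrp; lia.
  have [u' hu' eu'] := wmove _ _ hw ha.
  exists (h * u'), a, b; rewrite !groupM //; split => //.
  have cw : commute (w i.+1) (w k.+1 ^+ b) by apply/commuteX/w_commute; lia.
  by rewrite -!mulgA -cw (mulgA _ (w _)) eu' !mulgA.
exists h, a, (~~ b); split => //; rewrite ik -!mulgA; congr (_ * (_ * _)).
case: b => /=; last by rewrite expg0 mul1g expg1.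
by rewrite expg1 expg0 -expg2 w_sqr //; lia.
Qed.

End Algebra.

(** * The signed permutation representation *)

Section SignedTransposition.

Variable I : finType.
Implicit Types (a b c d : I) (e : bool) (x : I * bool).

(** For distinct [a] and [b], the reflection in $e_a-e_b$ when [e] is false and in $e_a+e_b$ when
    [e] is true. *)
Definition sswap a b e x : I * bool :=
  if x.1 == a then (b, x.2 (+) e) else if x.1 == b then (a, x.2 (+) e) else x.

Ltac sswap_cases :=
  rewrite /sswap /=;
  repeat (rewrite ?eqxx /=; match goal with |- context [if ?y == ?z then _ else _] =>
    is_var y; is_var z; case: (y =P z) => ?; [subst | ] end);
  rewrite ?eqxx //=; try congruence.

Lemma sswapK a b e : involutive (sswap a b e).
Proof. by move=> [i u]; sswap_cases; rewrite addbK. Qed.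

Definition sperm a b e : {perm I * bool} := perm (inv_inj (sswapK a b e)).

Lemma spermE a b e x : sperm a b e x = sswap a b e x.
Proof. by rewrite permE. Qed.

Lemma sperm_sqr a b e : sperm a b e ^+ 2 = 1.
Proof. by apply/permP=> x; rewrite expg2 permM !spermE sswapK perm1. Qed.

Lemma sperm_braid a b c e e' : uniq [:: a; b; c] ->
  (sperm a b e * sperm b c e') ^+ 3 = 1.
Proof.
rewrite /= !inE negb_or -!andbA andbT => /and3P[/eqP ab /eqP ac /eqP bc].
apply/permP=> -[i u]; rewrite !expgS expg0 mulg1 !permM !spermE perm1.
by sswap_cases; case: u e e' => -[] [].
Qed.

Lemma sperm_commute_sqr a b c d e e' :
  commute (sperm a b e) (sperm c d e') -> (sperm a b e * sperm c d e') ^+ 2 = 1.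
Proof. by move=> h; rewrite expgMn // !sperm_sqr mulg1. Qed.

Lemma sperm_disjoint a b c d e e' : uniq [:: a; b; c; d] ->
  (sperm a b e * sperm c d e') ^+ 2 = 1.
Proof.
rewrite /= !inE !negb_or -!andbA andbT => /and5P[/eqP ? /eqP ? /eqP ? /eqP ? /andP[/eqP ? /eqP ?]].
apply/sperm_commute_sqr/permP=> -[i u]; rewrite !permM !spermE.
by sswap_cases.
Qed.

Lemma sperm_same a b e e' : (sperm a b e * sperm a b e') ^+ 2 = 1.
Proof.
apply/sperm_commute_sqr/permP=> -[i u]; rewrite !permM !spermE.
by sswap_cases; rewrite addbAC.
Qed.

End SignedTransposition.

Lemma inord_eq n i j : i <= n -> j <= n -> (inord i == inord j :> 'I_n.+1) = (i == j).
Proof. by move=> hi hj; rewrite -val_eqE /= !inordK. Qed.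

(* Coordinates are numbered from 1, as in the paper; index 0 of ['I_n.+1] is idle. *)
Definition coxs n i : {perm 'I_n.+1 * bool} := sperm (inord i) (inord i.+1) false.
Definition coxp n : {perm 'I_n.+1 * bool} := sperm (inord 1) (inord 2) true.

Lemma sperm_Dn_rel n : 2 <= n -> Dn_rel n (coxp n) (@coxs n).
Proof.
move=> n2; split.
- by split=> [|i _]; apply: sperm_sqr.
- move=> i hi hin; apply: sperm_braid; rewrite /= !inE !inord_eq; lia.
- move=> i j hi hj hij; apply: sperm_disjoint; rewrite /= !inE !inord_eq; lia.
- move=> hn; apply: sperm_braid; rewrite /= !inE !inord_eq; lia.
(* $s_{1'}$ and $s_1$ exchange the same two coordinates with different signs; for $i>2$ the supports
   are disjoint. *)
move=> i hi i2; have [->|i3] : i = 1%N \/ 2 < i by lia.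
  exact: sperm_same.
apply: sperm_disjoint; rewrite /= !inE !inord_eq; lia.
Qed.

(** * The action of the generators and of $H_k$ on signed coordinates *)

Section Representation.

Variables (gT : finGroupType) (n : nat) (G : {group gT}) (sp : gT) (s : nat -> gT).
Hypothesis rel : Dn_rel n sp s.
Hypothesis Gsp : sp \in G.
Hypothesis Gs : forall i, 0 < i < n -> s i \in G.
Variable f : {morphism G >-> {perm 'I_n.+1 * bool}}.
Hypothesis fsp : f sp = coxp n.
Hypothesis fs : forall i, 0 < i < n -> f (s i) = coxs n i.

Local Notation w := (wD sp s).
Local Notation t := (tD s).
Local Notation hyper := (hyper sp s).
Local Notation pt i c := ((inord i, c) : 'I_n.+1 * bool).

Lemma Gw k : 0 < k < n -> w k \in G.
Proof.
elim: k => // -[|k] IH hk; first by rewrite w1E groupM ?Gs.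
by rewrite (wS rel) ?groupJ ?IH ?Gs //; lia.
Qed.

Lemma Gt k : k <= n -> t k \in G.
Proof.
move=> kn; rewrite /tD big_nat; apply: group_prod => i hi; apply: Gs; lia.
Qed.

Lemma hyperG k : k < n -> hyper k \subset G.
Proof.
by move=> kn; apply: hyper_sub => i hi; [apply: Gs | apply: Gw]; lia.
Qed.

Lemma sperm_pt i j k e c : i <= n -> j <= n -> k <= n ->
  sperm (inord j) (inord k) e (pt i c) =
    if i == j then pt k (c (+) e) else if i == k then pt j (c (+) e) else pt i c.
Proof. by move=> hi hj hk; rewrite spermE /sswap /= !inord_eq. Qed.

Lemma fs_pt i j c : 0 < j < n -> i <= n ->
  f (s j) (pt i c) = if i == j then pt j.+1 c else if i == j.+1 then pt j c else pt i c.
Proof. by move=> hj hi; rewrite fs // sperm_pt ?addbF //; lia. Qed.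

Lemma fM_pt x y p : x \in G -> y \in G -> f (x * y) p = f y (f x p).
Proof. by move=> hx hy; rewrite morphM // permM. Qed.

Lemma fw_pt k i c : 0 < k < n -> i <= n ->
  f (w k) (pt i c) = pt i (c (+) ((i == 1%N) || (i == k.+1))).
Proof.
elim: k i c => // -[|k] IH i c hk hi.
  rewrite w1E fM_pt ?Gs // fs_pt // fsp.
  case: (eqVneq i 1%N) => [->|i1]; first by rewrite sperm_pt //; lia.
  case: (eqVneq i 2) => [->|i2]; first by rewrite sperm_pt //; lia.
  by rewrite sperm_pt ?(negbTE i1) ?(negbTE i2) ?addbF //; lia.
have Gsk : s k.+2 \in G by apply: Gs; lia.
have Gwk : w k.+1 \in G by apply: Gw; lia.
rewrite (wS rel) //.
have e32 : (k.+3 == k.+2) = false by lia.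
have e23 : (k.+2 == k.+3) = false by lia.
(* Only the action of $w_{k+1}$ is kept, so that just the conjugation by $s_{k+2}$ is expanded. *)
move: (w k.+1) Gwk IH => x Gx IH.
rewrite conjgE (sV rel) // !fM_pt ?groupM //.
rewrite fs_pt //; case: (eqVneq i k.+2) => [->|i1] /=; [| case: (eqVneq i k.+3) => [->|i2] /=].
- by rewrite IH ?fs_pt ?e32 ?e23 ?eqxx //; lia.
- by rewrite IH ?fs_pt ?eqxx ?orbT //; lia.
by rewrite IH ?fs_pt ?(negbTE i1) ?(negbTE i2) //; lia.
Qed.

Lemma ft_high k i c : 0 < k <= n -> k < i <= n -> f (t k) (pt i c) = pt i c.
Proof.
elim: k => // -[|k] IH hk hi; first by rewrite /tD big_geq // morph1 perm1.
rewrite /tD big_nat_recr //= fM_pt; [| apply: Gt; lia | apply: Gs; lia].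
by rewrite IH ?fs_pt //; try lia; do 2?[case: eqP => //]; lia.
Qed.

(** Products act from left to right: among $s_1,\dots,s_{k-1}$ the first to move $i+1$ is $s_i$, and
    the later ones fix $i$. *)
Lemma ft_step k i c : 0 < i < k -> k <= n -> f (t k) (pt i.+1 c) = pt i c.
Proof.
elim: k => [|[|k] IH] hi hk; try lia.
rewrite /tD big_nat_recr //= fM_pt; [| apply: Gt; lia | apply: Gs; lia].
have [e|e] : i = k.+1 \/ i < k.+1 by lia.
  by rewrite e ft_high ?fs_pt ?eqxx; try lia; case: eqP => //; lia.
by rewrite IH ?fs_pt //; try lia; do 2?[case: eqP => //]; lia.
Qed.

Lemma ftX_high k i a c : 0 < k <= n -> k < i <= n -> f (t k ^+ a) (pt i c) = pt i c.
Proof.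
move=> hk hi; elim: a => [|a IH]; first by rewrite morph1 perm1.
by rewrite expgSr fM_pt ?groupX ?Gt ?IH ?ft_high //; lia.
Qed.

Lemma ftX_top k a c : 0 < k <= n -> a < k -> f (t k ^+ a) (pt k c) = pt (k - a) c.
Proof.
move=> hk; elim: a => [|a IH] ha; first by rewrite morph1 perm1 subn0.
rewrite expgSr fM_pt ?groupX ?Gt ?IH //; try lia.
by rewrite (_ : k - a = (k - a.+1).+1)%N ?ft_step //; lia.
Qed.

(** Inverses are absent because in a finite group products of generators exhaust the generated
    subgroup. The product step receives membership in [G], where [f] is multiplicative. *)
Lemma hyper_ind k (P : gT -> Prop) : k < n ->
  P 1 -> (forall x y, x \in G -> y \in G -> P x -> P y -> P (x * y)) ->
  (forall i, 0 < i < k -> P (s i)) -> (forall i, 0 < i <= k -> P (w i)) ->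
  forall g, g \in hyper k -> P g.
Proof.
move=> kn P1 PM Ps Pw _ /gen_prodgP[l [c hc ->]].
suff [] : \prod_i c i \in G /\ P (\prod_i c i) by [].
apply: (big_ind (fun x => x \in G /\ P x)) => [|x y [Gx Px] [Gy Py]|i _].
- by rewrite group1.
- by rewrite groupM //; split=> //; apply: PM.
split; first by apply: (subsetP (hyperG kn)); apply: mem_gen.
case/setUP: (hc i) => /imsetP[j]; rewrite ?inE => hj ->.
  by apply: Ps; rewrite hj ltn_ord.
by apply: Pw; rewrite /= ltn_ord.
Qed.

Lemma hyper_high k g i c : k < n -> k.+1 < i <= n -> g \in hyper k ->
  f g (pt i c) = pt i c.
Proof.
move=> kn hi; move: g; apply: (hyper_ind kn).
- by rewrite morph1 perm1.
- by move=> x y Gx Gy hx hy; rewrite fM_pt // hx.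
- move=> j hj; rewrite fs_pt; try lia.
  have [-> ->] : (i == j) = false /\ (i == j.+1) = false by lia.
  by [].
move=> j hj; rewrite fw_pt; try lia.
have [-> ->] : (i == 1%N) = false /\ (i == j.+1) = false by lia.
by rewrite addbF.
Qed.

Lemma hyper_last k g : k < n -> g \in hyper k ->
  exists e, forall c, f g (pt k.+1 c) = pt k.+1 (c (+) e).
Proof.
move=> kn; move: g; apply: (hyper_ind kn).
- by exists false => c; rewrite morph1 perm1 addbF.
- move=> x y Gx Gy [e he] [e' he']; exists (e (+) e') => c.
  by rewrite fM_pt // he he' addbA.
- move=> j hj; exists false => c; rewrite fs_pt; try lia.
  have [-> ->] : (k.+1 == j) = false /\ (k.+1 == j.+1) = false by lia.
  by rewrite addbF.
move=> j hj; exists ((k.+1 == 1%N) || (k.+1 == j.+1)) => c.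
by rewrite fw_pt; try lia.
Qed.

Lemma hyper_low k g i c : k < n -> 0 < i <= k -> g \in hyper k ->
  exists2 j, 0 < j <= k & exists e, f g (pt i c) = pt j e.
Proof.
move=> kn hi hg; move: g hg i c hi; apply: (hyper_ind kn).
- by move=> i c hi; exists i => //; exists c; rewrite morph1 perm1.
- move=> x y Gx Gy hx hy i c hi.
  have [j hj [e he]] := hx i c hi; have [j' hj' [e' he']] := hy j e hj.
  by exists j' => //; exists e'; rewrite fM_pt // he.
- move=> j hj i c hi; rewrite fs_pt; try lia.
  case: eqP => [_|_]; first by exists j.+1; [lia | exists c].
  by case: eqP => [_|_]; [exists j; [lia | exists c] | exists i => //; exists c].
move=> j hj i c hi; exists i => //; rewrite fw_pt; try lia.
by eexists.
Qed.

Lemma hyper_neg k g (x : 'I_n.+1 * bool) : k < n -> g \in hyper k ->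
  f g (x.1, ~~ x.2) = ((f g x).1, ~~ (f g x).2).
Proof.
move=> kn hg; move: g hg x; apply: (hyper_ind kn).
- by move=> x; rewrite morph1 !perm1.
- by move=> x y Gx Gy hx hy p; rewrite !fM_pt // hx hy.
- move=> j hj [p e] /=; rewrite fs; last lia.
  by rewrite /coxs !spermE /sswap /= !addbF; do 2?[case: (_ == _)].
move=> j hj [p e] /=; have hp : p <= n by rewrite -ltnS.
by rewrite -(inord_val p) !fw_pt /= ?addNb //; lia.
Qed.

(** * Coset representatives and the order of $H_k$ *)

(** The factor of index $k+1$ in a word; its first exponent runs over $0,\dots,k$. *)
Definition coset_rep k (ab : 'I_k.+1 * bool) : gT := t k.+1 ^+ ab.1 * w k.+1 ^+ ab.2.

Lemma t_hyper k m : 0 < k <= m -> t k \in hyper m.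
Proof.
by move=> hk; rewrite /tD big_nat; apply: group_prod => i hi; apply: s_hyper; lia.
Qed.

Lemma coset_rep_hyper k ab : @coset_rep k ab \in hyper k.+1.
Proof.
by apply: groupM; apply: groupX; [apply: t_hyper | apply: w_hyper]; rewrite /= leqnn.
Qed.

Lemma coset_rep_G k ab : k.+1 < n -> @coset_rep k ab \in G.
Proof. by move=> kn; apply: (subsetP (hyperG kn)); apply: coset_rep_hyper. Qed.

Lemma fwX_pt k i c (b : bool) : 0 < k < n -> i <= n ->
  f (w k ^+ b) (pt i c) = pt i (c (+) (b && ((i == 1%N) || (i == k.+1)))).
Proof.
move=> hk hi; case: b => /=; first by rewrite expg1 fw_pt.
by rewrite expg0 morph1 perm1 addbF.
Qed.

Lemma coset_rep_top k a b c : k.+1 < n ->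
  exists e, f (@coset_rep k (a, b)) (pt k.+1 c) = pt (k.+1 - a) e.
Proof.
move=> kn; rewrite /coset_rep fM_pt ?groupX ?Gw ?Gt //=; try lia.
by rewrite ftX_top // ?fwX_pt; try lia; eexists.
Qed.

Lemma coset_rep_next k a b c : k.+1 < n ->
  f (@coset_rep k (a, b)) (pt k.+2 c) = pt k.+2 (c (+) b).
Proof.
move=> kn; rewrite /coset_rep fM_pt ?groupX ?Gw ?Gt //=; try lia.
by rewrite ftX_high ?fwX_pt ?eqxx ?orbT ?andbT //; lia.
Qed.

Lemma pt_inj i j c e : i <= n -> j <= n -> pt i c = pt j e -> i = j /\ c = e.
Proof.
by move=> hi hj [/eqP]; rewrite inord_eq // => /eqP -> ->.
Qed.

Lemma coset_rep_inj k : k.+1 < n -> injective (fun ab => hyper k :* @coset_rep k ab).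
Proof.
move=> kn [a b] [a' b'] /rcoset_eqP/rcosetP[h hh eq].
have hkn : k < n by lia.
have Gh : h \in G by apply: (subsetP (hyperG hkn)).
have Gr ab := @coset_rep_G k ab kn.
(* The sign at $k+2$, which [h] fixes, determines the exponent of $w_{k+1}$. *)
have eb : b = b'.
  have := coset_rep_next a b false kn.
  rewrite eq fM_pt // (hyper_high false hkn _ hh) ?leqnn //.
  by rewrite coset_rep_next // => /pt_inj[] //.
(* The image of $k+1$ up to sign, which [h] does not affect, determines the exponent of
   $t_{k+1}$. *)
have [e he] := hyper_last hkn hh.
have [e1] := coset_rep_top a b e kn; rewrite eq fM_pt // he.
have [e2 ->] := coset_rep_top a' b' (e (+) e) kn.
have ha := ltn_ord a; have ha' := ltn_ord a'.
move=> /pt_inj[]; try lia; move=> ea _; congr (_, _) => //.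
by apply: val_inj => /=; lia.
Qed.

Lemma card_coset_reps k : k.+1 < n ->
  #|[set hyper k :* coset_rep ab | ab : 'I_k.+1 * bool]| = (k.+1 * 2)%N.
Proof.
by move=> kn; rewrite card_imset ?card_prod ?card_ord ?card_bool //; apply: coset_rep_inj.
Qed.

(** A counting argument: $2(k+1)$ distinct cosets are exhibited, and [hyper_coset] allows no more,
    so the two kinds of representatives need not be rewritten into each other. *)
Lemma rcosets_hyper k : k.+1 < n ->
  rcosets (hyper k) (hyper k.+1) = [set hyper k :* coset_rep ab | ab : 'I_k.+1 * bool].
Proof.
move=> kn; apply/esym/eqP; rewrite eqEcard; apply/andP; split.
  apply/subsetP=> _ /imsetP[ab _ ->]; apply/rcosetsP; exists (coset_rep ab) => //.
  exact: coset_rep_hyper.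
rewrite card_coset_reps //.
pose F (ab : 'I_k.+1 * bool) := hyper k :* (down s k.+1 ab.1.+1 * w k.+1 ^+ ab.2).
have -> : (k.+1 * 2 = #|[set: 'I_k.+1 * bool]|)%N.
  by rewrite cardsT card_prod card_ord card_bool.
apply: leq_trans (leq_imset_card F _).
apply/subset_leq_card/subsetP=> _ /rcosetsP[g hg ->].
have [h [a [b [hh ha ->]]]] := hyper_coset rel kn hg.
have ha' : a.-1 < k.+1 by lia.
apply/imsetP; exists (Ordinal ha', b) => //; rewrite /F /= prednK; last lia.
by rewrite rcosetM rcoset_id.
Qed.

Lemma hyper_decomp k g : k.+1 < n -> g \in hyper k.+1 ->
  exists h (ab : 'I_k.+1 * bool), h \in hyper k /\ g = h * coset_rep ab.
Proof.
move=> kn hg; have : hyper k :* g \in rcosets (hyper k) (hyper k.+1).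
  by apply/rcosetsP; exists g.
rewrite rcosets_hyper // => /imsetP[ab _ /rcoset_eqP/rcosetP[h hh ->]].
by exists h, ab.
Qed.

Lemma hyper0 : hyper 0 = 1%G.
Proof.
by apply/trivGP; apply: hyper_sub => i; lia.
Qed.

Lemma card_hyper k : k < n -> #|hyper k| = (2 ^ k * k`!)%N.
Proof.
elim: k => [|k IH] kn; first by rewrite hyper0 cards1.
rewrite -(Lagrange (hyperS sp s k)) IH; last lia.
by rewrite /indexg rcosets_hyper // card_coset_reps // factS expnS; lia.
Qed.

(** $H_k$ may also change the sign of $k+1$, so the point is that no element changes that sign
    alone. Induction on [k] through the decomposition $g = h\, t_{k+1}^a w_{k+1}^b$. *)
Lemma hyper_faithful k g : k < n -> g \in hyper k ->
  (forall i c, 0 < i <= k -> f g (pt i c) = pt i c) -> g = 1.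
Proof.
elim: k g => [|k IH] g kn; first by rewrite hyper0 => /set1P.
have hkn : k < n by lia.
move=> /(hyper_decomp kn)[h [[a b] [hh ->]]] fix_g.
have Gh : h \in G by apply: (subsetP (hyperG hkn)).
have Gr ab := @coset_rep_G k ab kn.
have [e he] := hyper_last hkn hh.
(* The image of $k+1$ is $\pm(k+1-a)$, and it must be $k+1$. *)
have a0 : a = ord0.
  have := fix_g k.+1 e; rewrite fM_pt // he.
  have [e1 ->] := coset_rep_top a b (e (+) e) kn.
  have ha := ltn_ord a.
  by move=> /(_ _)/pt_inj[]; try lia; move=> ea _; apply: val_inj => /=; lia.
move: fix_g {Gr}; rewrite a0 /coset_rep /= expg0 mul1g.
have Gwk : w k.+1 \in G by apply: Gw; lia.
case: b => fix_g; last first.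
  rewrite expg0 mulg1 in fix_g *; apply: IH => // i c hi; apply: fix_g; lia.
rewrite expg1 in fix_g *.
(* If $b=1$, then on the first $k+1$ coordinates [h] acts as $w_{k+1}^{-1}$, changing only the sign
   of 1. This is to be refuted. *)
have fh i c : 0 < i <= k.+1 -> f h (pt i c) = pt i (c (+) (i == 1%N)).
  move=> hi; have := fix_g i c hi; rewrite fM_pt //.
  move=> /(canRL (permK _)) ->; rewrite -morphV // (wV rel); last lia.
  have ik : (i == k.+2) = false by lia.
  by rewrite fw_pt ?ik ?orbF //; lia.
case: k {a a0} IH kn hkn hh he Gwk fix_g fh => [|k] IH kn hkn hh he Gwk fix_g fh.
  move: hh; rewrite hyper0 => /set1P h1; have := fh 1%N false isT.
  by rewrite h1 morph1 perm1 => /pt_inj[]; lia.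
have hw : w k.+1 \in hyper k.+1 by apply: w_hyper; lia.
have Gw' : w k.+1 \in G by apply: (subsetP (hyperG hkn)).
(* After the shift of [k], $w_{k+1}$ also changes only the sign of 1 among the first $k+1$
   coordinates. So $h=w_{k+1}$ by induction; but this changes the sign of $k+2$, which [fh] says is
   fixed. *)
have : h * w k.+1 = 1.
  apply: IH => //; first by rewrite groupM.
  move=> i c hi; rewrite fM_pt // fh ?fw_pt; try lia.
  have -> : (i == k.+2) = false by lia.
  by rewrite orbF addbK.
move=> /(canRL (mulgK _)); rewrite mul1g => hE.
have := fh k.+2 false; rewrite hE (wV rel) // fw_pt //; try lia.
by rewrite eqxx orbT => /(_ _)/pt_inj[]; lia.
Qed.

(** * Identification of $H_m$ with the set of words *)

Lemma word_eltE m (i j : nat -> nat) : 0 < m ->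
  word_elt sp s m i j = \prod_(1 <= k < m.+1) (t k ^+ i k * w k ^+ j k).
Proof.
move=> m0; have t1 : t 1%N = 1 by rewrite /tD big_geq.
by rewrite /word_elt [RHS]big_ltn // t1 expg1n mul1g.
Qed.

Lemma hyper_word k g : k < n -> g \in hyper k ->
  exists (i : nat -> nat) (j : nat -> bool),
    (forall l, 0 < l -> i l < l) /\ g = \prod_(1 <= l < k.+1) (t l ^+ i l * w l ^+ j l).
Proof.
elim: k g => [|k IH] g kn.
  rewrite hyper0 => /set1P ->; exists (fun=> 0%N), xpred0.
  by rewrite big_geq.
move=> /(hyper_decomp kn)[h [[a b] [hh ->]]].
have [i [j [hi ->]]] := IH h (ltnW kn) hh.
exists (fun l => if l == k.+1 then a : nat else i l), (fun l => if l == k.+1 then b else j l).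
split=> [l l0|]; first by case: eqP => [->|_]; [apply: ltn_ord | apply: hi].
rewrite [RHS]big_nat_recr //= eqxx; congr (_ * _).
by apply: eq_big_nat => l hl; rewrite (_ : l == k.+1 = false) //; lia.
Qed.

Lemma word_set_hyper m : 0 < m < n -> word_set sp s m = hyper m.
Proof.
move=> /andP[m0 mn]; apply/setP=> g; apply/imset2P/idP.
  move=> [i j _ _ ->]; rewrite word_eltE // big_nat; apply: group_prod => k hk.
  by rewrite groupM ?groupX ?t_hyper ?w_hyper //; lia.
move=> /(hyper_word mn)[i [j [hi ->]]].
(* The bound $i_k<k\le m$ makes the encoding of exponents in ['I_m.+1] lossless. *)
have iE (k : 'I_m.+1) : 0 < k -> (inord (i k) : 'I_m.+1) = i k :> nat.
  by move=> k0; rewrite inordK //; have := hi k k0; have := ltn_ord k; lia.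
exists [ffun k : 'I_m.+1 => inord (i k)] [ffun k : 'I_m.+1 => j k] => //.
  rewrite inE; apply/forallP=> k; apply/implyP=> k2.
  by rewrite ffunE iE; [apply: hi|]; lia.
rewrite word_eltE //; apply: eq_big_nat => k hk.
by rewrite !ffunE iE inordK //; lia.
Qed.

(** * Restriction to the first coordinates *)

(** The coordinates $1,\dots,m+1$ are renumbered from 0, as in [Bset]; the group restricted is
    $H_{m+1}$. *)
Definition lower_fun m (p : {perm 'I_n.+1 * bool}) (x : 'I_m.+1 * bool) : 'I_m.+1 * bool :=
  let y := p (pt x.1.+1 x.2) in (inord y.1.-1, y.2).

(* The default value 1 is never taken on the image of [hyper m.+1]. *)
Definition lower m (p : {perm 'I_n.+1 * bool}) : {perm 'I_m.+1 * bool} :=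
  insubd (1 : {perm 'I_m.+1 * bool}) [ffun x => lower_fun p x].

Lemma lower_funE m g (x : 'I_m.+1 * bool) : m.+1 < n -> g \in hyper m.+1 ->
  f g (pt x.1.+1 x.2) = pt (lower_fun (f g) x).1.+1 (lower_fun (f g) x).2.
Proof.
move=> mn hg; have hx : 0 < x.1.+1 <= m.+1 by rewrite /= ltn_ord.
have [j hj [e he]] := hyper_low x.2 mn hx hg.
rewrite /lower_fun he /= (inordK (_ : j < n.+1)); last lia.
by rewrite inordK ?prednK //; lia.
Qed.

Lemma lowerE m g (x : 'I_m.+1 * bool) : m.+1 < n -> g \in hyper m.+1 ->
  lower m (f g) x = lower_fun (f g) x.
Proof.
move=> mn hg; rewrite -pvalE /lower /=.
rewrite [pval _](val_insubd (1 : {perm _})) ifT ?ffunE //.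
(* Injectivity, inherited from [f g], keeps [insubd] from returning its default. *)
apply/injectiveP=> y z; rewrite !ffunE => eyz.
have := lower_funE y mn hg; rewrite eyz -(lower_funE z mn hg) => /perm_inj/pt_inj[].
- exact: leq_trans (ltn_ord _) (ltnW mn).
- exact: leq_trans (ltn_ord _) (ltnW mn).
by case: y z {eyz} => [y b] [z c] /= [/val_inj ->] ->.
Qed.

Lemma lowerM m : m.+1 < n -> {in hyper m.+1 &, {morph (fun g => lower m (f g)) : x y / x * y}}.
Proof.
move=> mn x y hx hy; apply/permP=> z; rewrite permM !lowerE ?groupM //.
have Gx : x \in G := subsetP (hyperG mn) x hx.
have Gy : y \in G := subsetP (hyperG mn) y hy.
by rewrite {1}/lower_fun fM_pt // lower_funE.
Qed.

End Representation.

(** * The order of $B_m$ and the isomorphism *)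

(** A signed permutation is determined by the signs and the absolute values of the images of
    positive elements, and these absolute values are distinct. *)
Lemma card_Bset m : #|Bset m| <= 2 ^ m * m`!.
Proof.
pose F (p : {perm 'I_m * bool}) :=
  ([ffun i => (p (i, false)).2], [ffun i => (p (i, false)).1]).
have Bneg p i : p \in Bset m -> p (i, true) = sneg (p (i, false)).
  by rewrite inE => /forallP/(_ (i, false))/eqP.
have Finj : {in Bset m &, injective F}.
  move=> p q Bp Bq [/ffunP e2 /ffunP e1].
  have e i : p (i, false) = q (i, false).
    by have := e1 i; have := e2 i; rewrite !ffunE; case: (p _) (q _) => ? ? [? ?] /= -> ->.
  by apply/permP=> -[i []]; rewrite ?Bneg // e.
rewrite -(card_in_imset Finj).
have -> : (2 ^ m * m`! =
    #|setX [set: {ffun 'I_m -> bool}] [set h : {ffun 'I_m -> 'I_m} | injectiveb h]|)%N.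
  by rewrite cardsX cardsT card_ffun card_bool card_inj_ffuns !card_ord ffactnn.
apply/subset_leq_card/subsetP=> _ /imsetP[p Bp ->]; rewrite !inE /=.
apply/injectiveP=> i j; rewrite !ffunE => e1.
have [e2|e2] : (p (i, false)).2 = (p (j, false)).2 \/ (p (i, false)).2 = ~~ (p (j, false)).2.
  by case: ((p _).2) ((p _).2) => [] []; [left|right|right|left].
- have : p (i, false) = p (j, false) by apply: injective_projections.
  by move=> /perm_inj[].
have : p (i, false) = p (j, true).
  by rewrite Bneg //; apply: injective_projections.
by move=> /perm_inj.
Qed.

Lemma hyper_isog (gT : finGroupType) (n : nat) (G : {group gT}) (sp : gT)
    (s : nat -> gT) (f : {morphism G >-> {perm 'I_n.+1 * bool}}) (m : nat) :
  Dn_rel n sp s -> sp \in G -> (forall i, 0 < i < n -> s i \in G) ->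
  f sp = coxp n -> (forall i, 0 < i < n -> f (s i) = coxs n i) ->
  0 < m < n -> hyper sp s m \isog Bset m.
Proof.
move=> rel Gsp Gs fsp fs; case: m => // m /= mn.
pose phi := Morphism (lowerM rel Gsp Gs fsp fs mn).
have phiE g (x : 'I_m.+1 * bool) : g \in hyper sp s m.+1 -> phi g x = lower_fun (f g) x.
  by move=> hg; apply: (lowerE rel Gsp Gs fsp fs).
have low g (x : 'I_m.+1 * bool) : g \in hyper sp s m.+1 ->
    f g (inord x.1.+1, x.2) = (inord (phi g x).1.+1, (phi g x).2).
  by move=> hg; rewrite phiE //; apply: (lower_funE rel Gsp Gs fsp fs).
(* Injectivity is [hyper_faithful]; the image lies in [Bset m.+1], whose order is at most that of
   $H_{m+1}$, so it is everything. *)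
have inj : 'injm phi.
  apply/subsetP=> g /morphpreP[hg /set1P g1]; apply/set1P.
  apply: (hyper_faithful rel Gsp Gs fsp fs mn hg) => i c hi.
  have im : i.-1 < m.+1 by lia.
  by have := low g (Ordinal im, c) hg; rewrite g1 perm1 /= prednK //; lia.
suff <- : phi @* hyper sp s m.+1 = Bset m.+1 by apply: sub_isog.
apply/eqP; rewrite eqEcard; apply/andP; split; last first.
  by rewrite card_injm // (card_hyper rel Gsp Gs fsp fs mn) card_Bset.
apply/subsetP=> _ /morphimP[g _ hg ->]; rewrite inE; apply/forallP=> x; apply/eqP.
by rewrite !phiE // /lower_fun /= (hyper_neg rel Gsp Gs fsp fs (_, _) mn hg).
Qed.

Theorem mainTheorem3 (gT : finGroupType) (n : nat) (G : {group gT})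
  (sp : gT) (s : nat -> gT) (m : nat) :
  2 <= n -> is_Coxeter_Dn n G sp s -> 0 < m -> m < n ->
  [/\ group_set (word_set sp s m),
      word_set sp s m \subset G
    & word_set sp s m \isog Bset m].
Proof.
move=> n2 [GE rel univ] m0 mn.
have Gsp : sp \in G by rewrite GE; apply/mem_gen/setU11.
have Gs i : 0 < i < n -> s i \in G.
  move=> hi; rewrite GE; apply/mem_gen/setU1P; right.
  have hi' : i.-1 < n.-1 by lia.
  by apply/imsetP; exists (Ordinal hi'); rewrite //= prednK //; case/andP: hi.
(* The universal property of $D_n$ provides the reflection representation. *)
have [f [fsp fs']] := univ _ _ _ (sperm_Dn_rel n2).
have fs i : 0 < i < n -> f (s i) = coxs n i by move=> hi; apply: fs'; lia.
rewrite (word_set_hyper rel Gsp Gs fsp fs); last by rewrite m0.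
split; [exact: groupP | exact: (hyperG rel Gsp Gs mn) |].
by apply: (hyper_isog rel Gsp Gs fsp fs); rewrite m0.
Qed.
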